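(* Let $F$ be a group and let $H_1,\ldots,H_n$ be subgroups of $F$. Then the nil-closure of the subset $H_1\cdots H_n=\{h_1\cdots h_n\mid h_i\in H_i\}$ of $F$ is the intersection, over all primes $p$, of the $p$-closures of $H_1\cdots H_n$; that is, $$\mathrm{Cl}_{nil}(H_1\cdots H_n)=\bigcap_{p\ \text{prime}}\mathrm{Cl}_{p}(H_1\cdots H_n).$$
   Context: A pseudovariety of groups is a class $\mathsf{H}$ of finite groups closed under finite direct products, subgroups and homomorphic images. For a group $G$, the pro-$\mathsf{H}$ topology on $G$ is the group topology having as a fundamental system of neighborhoods of the identity all normal subgroups $N$ of $G$ with $G/N\in\mathsf{H}$ (it need not be Hausdorff). For $X\subseteq G$, $\mathrm{Cl}_{\mathsf{H}}(X)$ denotes the closure of $X$ in the pro-$\mathsf{H}$ topology. Let $\mathsf{G_p}$ be the pseudovariety of all finite $p$-groups ($p$ a prime) and $\mathsf{G_{nil}}$ the pseudovariety of all finite nilpotent groups. The $p$-closure $\mathrm{Cl}_p(X)$ is $\mathrm{Cl}_{\mathsf{G_p}}(X)$ and the nil-closure $\mathrm{Cl}_{nil}(X)$ is $\mathrm{Cl}_{\mathsf{G_{nil}}}(X)$. *)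

(* Defs.v *)
From HB Require Import structures.
From mathcomp Require Import all_boot all_order all_fingroup all_solvable.
From mathcomp Require Import all_classical topology.

Set Implicit Arguments.
Unset Strict Implicit.
Unset Printing Implicit Defensive.

(* Class representative; [fingroup.repr] shadows the one of generic_quotient. *)
Local Notation qrepr := generic_quotient.repr.

Local Open Scope quotient_scope.
Local Open Scope classical_set_scope.
Local Open Scope group_scope.

Definition is_subgroup (G : groupType) (A : set G) : Prop :=
  group_closed [in A].

Lemma is_subgroupP (G : groupType) (A : set G) :
  is_subgroup A <->
  [/\ A 1, (forall x y, A x -> A y -> A (x * y)) & (forall x, A x -> A x^-1)].
Proof.
split=> [sA|[A1 AM AV]].
  split; first by have [/set_mem] := sA.
  - move=> x y Ax Ay; apply/set_mem.
    by apply: (group_closedM sA); exact/mem_set.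
  - by move=> x Ax; apply/set_mem; apply: (group_closedV sA); exact/mem_set.
split; first exact/mem_set.
by move=> x y /set_mem Ax /set_mem Ay; apply/mem_set/AM => //; exact: AV.
Qed.

Definition product_set (G : groupType) (n : nat) (H : 'I_n -> set G) : set G :=
  [set x | exists2 h : 'I_n -> G, forall i, H i (h i) & x = \prod_(i < n) h i].

Record normal_subgroup (G : groupType) := NormalSubgroup {
  nsub_set :> set G;
  nsub_subgroup : is_subgroup nsub_set;
  nsub_conj : forall x y, nsub_set x -> nsub_set (x ^ y)
}.

Section NormalSubgroupTheory.
Variables (G : groupType) (N : normal_subgroup G).

Lemma nsub1 : nsub_set N 1.
Proof. by have /is_subgroupP[] := nsub_subgroup N. Qed.

Lemma nsubM x y : nsub_set N x -> nsub_set N y -> nsub_set N (x * y).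
Proof. by have /is_subgroupP[_ NM _] := nsub_subgroup N; apply: NM. Qed.

Lemma nsubV x : nsub_set N x -> nsub_set N x^-1.
Proof. by have /is_subgroupP[_ _ NV] := nsub_subgroup N; apply: NV. Qed.

End NormalSubgroupTheory.

Section Quotient.
Variables (G : groupType) (N : normal_subgroup G).

Definition coset_rel (x y : G) : bool := x^-1 * y \in (N : set G).

Lemma coset_rel_refl : reflexive coset_rel.
Proof. by move=> x; rewrite /coset_rel mulVg; apply/mem_set/nsub1. Qed.

Lemma coset_rel_sym : symmetric coset_rel.
Proof.
suff h x y : coset_rel x y -> coset_rel y x.
  by move=> x y; apply/idP/idP; exact: h.
move=> /set_mem/nsubV Nxy; apply/mem_set; move: Nxy.
by rewrite invgM invgK.
Qed.

Lemma coset_rel_trans : transitive coset_rel.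
Proof.
move=> y x z /set_mem Nxy /set_mem Nyz; apply/mem_set.
by have := nsubM Nxy Nyz; rewrite -mulgA mulVKg.
Qed.

Definition coset_equiv : equiv_rel G :=
  EquivRel coset_rel coset_rel_refl coset_rel_sym coset_rel_trans.

Definition quotient_group : Type := {eq_quot coset_equiv}.

HB.instance Definition _ := Choice.on quotient_group.
HB.instance Definition _ := EqQuotient.on quotient_group.

Definition quot_pi (x : G) : quotient_group := \pi_quotient_group x.

Lemma quot_piP x y : quot_pi x = quot_pi y <-> nsub_set N (x^-1 * y).
Proof.
rewrite /quot_pi; split=> [/eqP|Nxy]; first by rewrite eqmodE => /set_mem.
by apply/eqP; rewrite eqmodE; exact/mem_set.
Qed.

Lemma quot_pi_surj (q : quotient_group) : exists x, q = quot_pi x.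
Proof. by exists (qrepr q); rewrite /quot_pi reprK. Qed.

Definition quot_mul (a b : quotient_group) : quotient_group :=
  quot_pi (qrepr a * qrepr b).
Definition quot_inv (a : quotient_group) : quotient_group :=
  quot_pi (qrepr a)^-1.

Lemma quot_repr x : nsub_set N ((qrepr (quot_pi x))^-1 * x).
Proof. by apply/quot_piP; rewrite /quot_pi reprK. Qed.

Lemma quot_mulE x y : quot_mul (quot_pi x) (quot_pi y) = quot_pi (x * y).
Proof.
apply/quot_piP; set a := qrepr _; set b := qrepr _.
have -> : (a * b)^-1 * (x * y) = ((a^-1 * x) ^ b) * (b^-1 * y).
  by rewrite conjgE invgM !mulgA mulgK.
by apply: nsubM; [apply: nsub_conj|]; exact: quot_repr.
Qed.

Lemma quot_invE x : quot_inv (quot_pi x) = quot_pi x^-1.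
Proof.
apply/quot_piP; set a := qrepr _.
have -> : a^-1^-1 * x^-1 = ((a^-1 * x)^-1) ^ a^-1.
  by rewrite conjgE invgM !invgK mulgK.
by apply/nsub_conj/nsubV; exact: quot_repr.
Qed.

Lemma quot_mulA : associative quot_mul.
Proof.
move=> a b c; have [x ->] := quot_pi_surj a; have [y ->] := quot_pi_surj b.
by have [z ->] := quot_pi_surj c; rewrite !quot_mulE mulgA.
Qed.

Lemma quot_mul1 : left_id (quot_pi 1) quot_mul.
Proof. by move=> a; have [x ->] := quot_pi_surj a; rewrite quot_mulE mul1g. Qed.

Lemma quot_mulr1 : right_id (quot_pi 1) quot_mul.
Proof. by move=> a; have [x ->] := quot_pi_surj a; rewrite quot_mulE mulg1. Qed.

Lemma quot_mulV : left_inverse (quot_pi 1) quot_inv quot_mul.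
Proof.
by move=> a; have [x ->] := quot_pi_surj a; rewrite quot_invE quot_mulE mulVg.
Qed.

Lemma quot_mulrV : right_inverse (quot_pi 1) quot_inv quot_mul.
Proof.
by move=> a; have [x ->] := quot_pi_surj a; rewrite quot_invE quot_mulE mulgV.
Qed.

HB.instance Definition _ := isGroup.Build quotient_group
  quot_mulA quot_mul1 quot_mulr1 quot_mulV quot_mulrV.

Lemma quot_piM : {morph quot_pi : x y / x * y}.
Proof. by move=> x y; rewrite -quot_mulE. Qed.

HB.instance Definition _ := isMultiplicative.Build G quotient_group quot_pi
  quot_piM.

End Quotient.

Record pseudovariety := Pseudovariety {
  pv_mem :> finGroupType -> Prop;
  pv_prod : forall (I : finType) (gT : I -> finGroupType),
    (forall i, pv_mem (gT i)) -> pv_mem {dffun forall i, gT i};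
  pv_sub : forall (gT : finGroupType) (K : {group gT}),
    pv_mem gT -> pv_mem (subg_of K);
  pv_img : forall (gT rT : finGroupType) (f : {morphism [set: gT]%SET >-> rT}),
    f @* [set: gT]%SET = [set: rT]%SET -> pv_mem gT -> pv_mem rT
}.

(* [V] is closed under isomorphism by [pv_img], so this does not depend on the
   choice of the finite group [Q] isomorphic to [G]. *)
Definition in_pseudovariety (V : pseudovariety) (G : groupType) : Prop :=
  exists2 Q : finGroupType, V Q &
    exists f : {multiplicative G -> Q}, bijective f.

Section QuotientInPseudovariety.
Variables (V : pseudovariety) (G : groupType).

Section Kernel.
Variables (Q : finGroupType) (f : {multiplicative G -> Q}).

Let fM : {morph f : x y / x * y} := @gmulfM _ _ f.

Let f1 : f 1 = 1.
Proof. by apply: (mulgI (f 1)); rewrite -fM !mulg1. Qed.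

Let fV x : f x^-1 = (f x)^-1.
Proof. by apply: (mulgI (f x)); rewrite -fM !mulgV f1. Qed.

Definition kernel_set : set G := [set x | f x = 1].

Lemma kernel_subgroup : is_subgroup kernel_set.
Proof.
apply/is_subgroupP; split=> [|x y|x]; rewrite /kernel_set /= ?f1//.
- by rewrite fM => -> ->; rewrite mulg1.
- by rewrite fV => ->; rewrite invg1.
Qed.

Lemma kernel_conj x y : kernel_set x -> kernel_set (x ^ y).
Proof.
by rewrite /kernel_set /= conjgE !fM fV => ->; rewrite mul1g mulVg.
Qed.

Definition kernel : normal_subgroup G :=
  NormalSubgroup kernel_subgroup kernel_conj.

Let im : {set Q} := [set q | `[< exists x, q = f x >]].

Let imP q : q \in im <-> exists x, q = f x.
Proof. by rewrite finset.in_set; split=> [/asboolP|?]; last exact/asboolP. Qed.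

Let im_group : group_set im.
Proof.
apply/group_setP; split; first by apply/imP; exists 1.
by move=> q r /imP[x ->] /imP[y ->]; apply/imP; exists (x * y).
Qed.

Let imG := Group im_group.

Let f_im x : f x \in imG.
Proof. by apply/imP; exists x. Qed.

Lemma kernel_in_pseudovariety (N : normal_subgroup G) :
  V Q -> (N : set G) = kernel_set -> in_pseudovariety V (quotient_group N).
Proof.
move=> VQ NE.
have fE x y : nsub_set N (x^-1 * y) <-> f x = f y.
  rewrite NE /kernel_set /= fM fV; split=> [|->]; last by rewrite mulVg.
  by move/(congr1 (mul (f x))); rewrite mulKVg mulg1.
pose g (a : quotient_group N) : (subg_of imG) := subg imG (f (qrepr a)).
have gE x : g (quot_pi N x) = subg imG (f x).
  by rewrite /g (_ : f _ = f x) //; apply/fE; exact: quot_repr.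
have gM : {morph g : a b / a * b}.
  move=> a b; have [x ->] := quot_pi_surj a; have [y ->] := quot_pi_surj b.
  by rewrite -quot_piM !gE fM morphM.
pose gm := isMultiplicative.Build _ _ g gM.
pose G' : {multiplicative quotient_group N -> (subg_of imG)} :=
  HB.pack g gm.
exists (subg_of imG); first exact: pv_sub.
exists G' => /=.
have /choice[h hE] (q : subg_of imG) : exists x, q = subg imG (f x).
  by have /imP[x qx] := subgP q; exists x; rewrite -qx sgvalK.
exists (fun q => quot_pi N (h q)) => [a|q] /=; last by rewrite gE -hE.
have [x ->] := quot_pi_surj a; apply/quot_piP/fE.
by have := hE (g (quot_pi N x)); rewrite gE => /(congr1 sgval); rewrite !subgK.
Qed.

End Kernel.

Lemma in_pseudovarietyP (N : normal_subgroup G) :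
  in_pseudovariety V (quotient_group N) <->
  exists2 Q : finGroupType, V Q &
    exists f : {multiplicative G -> Q}, (N : set G) = kernel_set f.
Proof.
split=> [[Q VQ [f [f' fK _]]]|[Q VQ [f NE]]]; last first.
  exact: kernel_in_pseudovariety VQ NE.
have gM : {morph (f \o quot_pi N) : x y / x * y}.
  by move=> x y; rewrite /= quot_piM gmulfM.
exists Q => //.
pose gm := isMultiplicative.Build _ _ (f \o quot_pi N) gM.
pose g : {multiplicative G -> Q} := HB.pack (f \o quot_pi N) gm.
exists g; apply/funext => x; rewrite /kernel_set /=; apply/propext.
have f1 : f (quot_pi N 1) = 1.
  by apply: (mulgI (f (quot_pi N 1))); rewrite -gmulfM -quot_piM !mulg1.
rewrite -f1; split=> [Nx|/(can_inj fK)/esym/quot_piP]; last first.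
  by rewrite invg1 mul1g.
by congr (f _); apply/esym/quot_piP; rewrite invg1 mul1g.
Qed.

Lemma whole_group_subproof : is_subgroup [set: G].
Proof. by apply/is_subgroupP. Qed.

Definition whole_group : normal_subgroup G :=
  @NormalSubgroup G [set: G] whole_group_subproof (fun _ _ _ => I).

Lemma whole_in_pseudovariety : in_pseudovariety V (quotient_group whole_group).
Proof.
apply/in_pseudovarietyP.
exists {dffun forall i : 'I_0, {perm bool}}.
  by apply: (pv_prod (gT := fun=> _)) => -[].
pose f (x : G) : {dffun forall i : 'I_0, {perm bool}} := 1.
have fM : {morph f : x y / x * y} by move=> x y; rewrite /f mulg1.
pose fm := isMultiplicative.Build _ _ f fM.
pose g : {multiplicative G -> {dffun forall i : 'I_0, {perm bool}}} :=
  HB.pack f fm.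
by exists g; apply/seteqP; split.
Qed.

Section Intersection.
Variables N M : normal_subgroup G.

Lemma inter_subgroup_subproof : is_subgroup ((N : set G) `&` M).
Proof.
apply/is_subgroupP; split; first by split; exact: nsub1.
  by move=> x y [? ?] [? ?]; split; exact: nsubM.
by move=> x [? ?]; split; exact: nsubV.
Qed.

Lemma inter_conj_subproof x y :
  ((N : set G) `&` M) x -> ((N : set G) `&` M) (x ^ y).
Proof. by move=> [? ?]; split; exact: nsub_conj. Qed.

Definition inter_normal : normal_subgroup G :=
  NormalSubgroup inter_subgroup_subproof inter_conj_subproof.

Lemma inter_in_pseudovariety :
  in_pseudovariety V (quotient_group N) ->
  in_pseudovariety V (quotient_group M) ->
  in_pseudovariety V (quotient_group inter_normal).
Proof.
move=> /in_pseudovarietyP[Q VQ [f NE]] /in_pseudovarietyP[R VR [g ME]].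
apply/in_pseudovarietyP.
pose T (b : bool) : finGroupType := if b then Q else R.
exists {dffun forall b, T b}; first by apply: pv_prod => -[].
pose h0 (x : G) (b : bool) : T b :=
  match b return T b with true => f x | false => g x end.
pose h (x : G) : {dffun forall b, T b} := finfun (h0 x).
have hE x b : h x b = h0 x b by rewrite ffunE.
have hM : {morph h : x y / x * y}.
  move=> x y; apply/ffunP=> b; rewrite mulg_ffun !hE.
  by case: b; exact: gmulfM.
pose hm := isMultiplicative.Build _ _ h hM.
pose k : {multiplicative G -> {dffun forall b, T b}} := HB.pack h hm.
exists k; rewrite /= NE ME; apply/seteqP; split=> x.
  by case=> fx gx; apply/ffunP => b; rewrite oneg_ffun hE; case: b.
move=> hx; have {hx} hb b : h0 x b = 1 by rewrite -hE -[h x]/(k x) hx oneg_ffun.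
by split; [exact: (hb true)|exact: (hb false)].
Qed.

End Intersection.

End QuotientInPseudovariety.

Definition pro_topology (V : pseudovariety) (G : groupType) : Type := G.

Section ProTopology.
Variables (V : pseudovariety) (G : groupType).
Local Notation T := (pro_topology V G).

HB.instance Definition _ := Group.on T.

(* Since N is normal, the left cosets x N are also the right cosets N x. *)
Definition pro_nbhs (x : T) : set_system T :=
  [set A | exists2 N : normal_subgroup G,
     in_pseudovariety V (quotient_group N) &
     [set x * y | y in (N : set G)] `<=` A].

HB.instance Definition _ := hasNbhs.Build T pro_nbhs.

Lemma pro_nbhs_filter (x : T) : ProperFilter (nbhs x).
Proof.
apply: Build_ProperFilter_ex.
  move=> A [N _ NA]; exists x; apply: NA.
  by exists 1; rewrite ?mulg1//; exact: nsub1.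
split.
- by exists (whole_group G); [exact: whole_in_pseudovariety|].
- move=> A B [N VN NA] [M VM MB]; exists (inter_normal N M).
    exact: inter_in_pseudovariety.
  by move=> _ [y [Ny My] <-]; split; [apply: NA|apply: MB]; exists y.
- by move=> A B AB [N VN NA]; exists N => //; exact: subset_trans AB.
Qed.

Lemma pro_nbhs_singleton (x : T) (A : set T) : nbhs x A -> A x.
Proof.
by move=> [N _ NA]; apply: NA; exists 1; rewrite ?mulg1//; exact: nsub1.
Qed.

Lemma pro_nbhs_nbhs (x : T) (A : set T) : nbhs x A -> nbhs x (nbhs^~ A).
Proof.
move=> [N VN NA]; exists N => // _ [y Ny <-]; exists N => // _ [z Nz <-].
by apply: NA; exists (y * z); rewrite ?mulgA//; exact: nsubM.
Qed.

HB.instance Definition _ := Nbhs_isNbhsTopological.Build T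
  pro_nbhs_filter pro_nbhs_singleton pro_nbhs_nbhs.

Lemma pro_mul_continuous : continuous (fun z : T * T => z.1 * z.2).
Proof.
move=> [x y] A [N VN NA]; rewrite /= in NA.
exists ([set x * u | u in (N : set G)], [set y * u | u in (N : set G)]).
  by split; exists N.
move=> [_ _] [/= [u Nu <-] [v Nv <-]]; apply: NA; exists (u ^ y * v).
  by apply: nsubM => //; exact: nsub_conj.
by rewrite conjgE !mulgA mulgK.
Qed.

Lemma pro_inv_continuous : continuous (fun x : T => x^-1).
Proof.
move=> x A [N VN NA]; exists N => // _ [u Nu <-]; apply: NA.
exists (u^-1 ^ x^-1); first exact/nsub_conj/nsubV.
by rewrite conjgE invgK invgM !mulgA mulVg mul1g.
Qed.

End ProTopology.

Definition Cl (V : pseudovariety) (G : groupType) (X : set G) : set G :=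
  @closure (pro_topology V G) X.

Lemma pgroup_prod (p : nat) (I : finType) (gT : I -> finGroupType) :
  (forall i, p.-group [set: gT i]%SET) ->
  p.-group [set: {dffun forall i, gT i}]%SET.
Proof.
move=> pT; rewrite /pgroup cardsT card_dep_ffun.
rewrite foldrE big_map; elim/big_ind: _ => // [m n pm pn|i _].
  by rewrite pnatM pm.
by have := pT i; rewrite /pgroup cardsT.
Qed.

Lemma pgroup_sub (p : nat) (gT : finGroupType) (K : {group gT}) :
  p.-group [set: gT]%SET -> p.-group [set: subg_of K]%SET.
Proof.
move=> pT; rewrite -im_subg; apply: morphim_pgroup.
exact: pgroupS (finset.subsetT K) pT.
Qed.

Lemma pgroup_img (p : nat) (gT rT : finGroupType)
    (f : {morphism [set: gT]%SET >-> rT}) :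
  f @* [set: gT]%SET = [set: rT]%SET ->
  p.-group [set: gT]%SET -> p.-group [set: rT]%SET.
Proof. by move=> <-; exact: morphim_pgroup. Qed.

Definition Gp (p : nat) : pseudovariety :=
  @Pseudovariety (fun gT => p.-group [set: gT]%SET)
    (@pgroup_prod p) (@pgroup_sub p) (@pgroup_img p).

Lemma nilpotent_prod (I : finType) (gT : I -> finGroupType) :
  (forall i, nilpotent [set: gT i]%SET) ->
  nilpotent [set: {dffun forall i, gT i}]%SET.
Proof.
move=> nT; have := setXn_dprod (fun i => [set: gT i]%G).
have -> : setXn (fun i => [set: gT i]%SET) = [set: {dffun forall i, gT i}]%SET.
  by apply/setP => x; rewrite in_setXn finset.in_setT; apply/forallP => i;
     rewrite finset.in_setT.
move=> /bigdprod_nil; apply => i _.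
by rewrite -(isog_nil (isog_setXn [set: gT i]%G)).
Qed.

Lemma nilpotent_sub (gT : finGroupType) (K : {group gT}) :
  nilpotent [set: gT]%SET -> nilpotent [set: subg_of K]%SET.
Proof.
move=> nT; rewrite -im_subg; apply: morphim_nil.
exact: nilpotentS (finset.subsetT K) nT.
Qed.

Lemma nilpotent_img (gT rT : finGroupType)
    (f : {morphism [set: gT]%SET >-> rT}) :
  f @* [set: gT]%SET = [set: rT]%SET ->
  nilpotent [set: gT]%SET -> nilpotent [set: rT]%SET.
Proof. by move=> <-; exact: morphim_nil. Qed.

Definition Gnil : pseudovariety :=
  @Pseudovariety (fun gT => nilpotent [set: gT]%SET)
    nilpotent_prod nilpotent_sub nilpotent_img.

Definition Cl_p (p : nat) (G : groupType) (X : set G) : set G := Cl (Gp p) X.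

Definition Cl_nil (G : groupType) (X : set G) : set G := Cl Gnil X.

(* Main.v *)
Require Import Defs.
From HB Require Import structures.
From mathcomp Require Import all_boot all_order all_fingroup all_solvable.
From mathcomp Require Import all_classical topology.

(** For nilpotent Q, the quotients Q / O_{q'}(Q) are q-groups and jointly
    separate points.  Given f : F -> Q and, for each prime p, an element
    h_p1 ... h_pn of H_1 ... H_n agreeing with x in Q / O_{p'}(Q), put
    k_i = \prod_p h_pi ^ e_p, where e_p is 1 modulo the p-part of |Q| and 0
    modulo its p'-part.  Modulo O_{q'}(Q) only the factor p = q survives, so
    k_1 ... k_n is an element of H_1 ... H_n with the same image as x in Q. *)

Local Open Scope classical_set_scope.
Local Open Scope group_scope.

Lemma multiplicative1 (G Q : groupType) (f : {multiplicative G -> Q}) :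
  f 1 = 1.
Proof. by apply: (mulgI (f 1)); rewrite -gmulfM !mulg1. Qed.

Lemma multiplicative_prod (G Q : groupType) (f : {multiplicative G -> Q})
    (I : Type) (r : seq I) (P : pred I) (E : I -> G) :
  f (\prod_(i <- r | P i) E i) = \prod_(i <- r | P i) f (E i).
Proof. exact: (big_morph f (@gmulfM _ _ f) (multiplicative1 _ _ f)). Qed.

Lemma multiplicativeX (G Q : groupType) (f : {multiplicative G -> Q}) n x :
  f (x ^+ n) = f x ^+ n.
Proof.
by elim: n => [|n IHn]; rewrite ?multiplicative1// !expgS gmulfM IHn.
Qed.

Lemma subgroup_prod (G : groupType) (A : set G) (I : Type) (r : seq I)
    (P : pred I) (E : I -> G) :
  is_subgroup A -> (forall i, P i -> A (E i)) -> A (\prod_(i <- r | P i) E i).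
Proof. by move=> /is_subgroupP[A1 AM _] AE; apply: big_ind. Qed.

Lemma subgroupX (G : groupType) (A : set G) n x :
  is_subgroup A -> A x -> A (x ^+ n).
Proof.
move=> /is_subgroupP[A1 AM _] Ax.
by elim: n => [|n IHn]; rewrite ?expg0// expgS; apply: AM.
Qed.

(** The cosets x ker f, with [f] into a member of [V], are the basic neighbourhoods of [x]; closure
    of [V] under subgroups lets [f] be any morphism. *)
Lemma ClP (V : pseudovariety) (G : groupType) (X : set G) (x : G) :
  Cl V X x <->
  forall Q : finGroupType, V Q -> forall f : {multiplicative G -> Q},
    exists2 y, X y & f y = f x.
Proof.
split=> [clx Q VQ f|clx A [N /in_pseudovarietyP[Q VQ [f NE]] NA]].
  have [|y [Xy [z fz zy]]] := clx [set x * z | z in kernel_set f].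
    exists (kernel f) => //; apply/in_pseudovarietyP.
    by exists Q => //; exists f.
  by exists y => //; rewrite -zy gmulfM (fz : f z = 1) mulg1.
have [y Xy fy] := clx Q VQ f; exists y; split=> //; apply: NA.
exists (x^-1 * y); last exact: mulVKg.
rewrite NE /kernel_set /= gmulfM fy -gmulfM mulVg.
exact: multiplicative1.
Qed.

(** By [ClP], every test morphism for [V] is also one for [W]. *)
Lemma Cl_sub (V W : pseudovariety) (G : groupType) (X : set G) :
  (forall Q, V Q -> W Q) -> Cl W X `<=` Cl V X.
Proof. by move=> VW x /ClP clx; apply/ClP => Q /VW; exact: clx. Qed.

(** Nilpotency makes O_{p'} a Hall p'-subgroup. This shows the quotient to be a p-group and bounds
    the orders of its elements. *)
Lemma card_quotient_pcore (gT : finGroupType) (p : nat) :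
  nilpotent [set: gT]%SET ->
  #|[set: coset_of 'O_p^'([set: gT]%SET)]%SET| = ((#|[set: gT]%SET|)`_p)%N.
Proof.
move=> nilT; rewrite -quotientT card_quotient ?gFnorm//.
have hallO := nilpotent_pcore_Hall (p^')%N nilT.
rewrite -divgS ?pcore_sub// (card_Hall hallO).
by rewrite -{1}(partnC p (cardG_gt0 [set: gT]%G)) mulnK.
Qed.

Lemma mem_norm_pcoreT (gT : finGroupType) (pi : nat_pred) (x : gT) :
  x \in 'N('O_pi([set: gT]%SET)).
Proof. by apply: (fintype.subsetP (gFnorm _ _)); rewrite finset.in_setT. Qed.

(** If x^-1 y is nontrivial, some prime p divides its order, whereas membership in O_{p'} makes that
    order prime to p. *)
Lemma pcore_separates (gT : finGroupType) (x y : gT) :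
  (forall p, prime p -> p %| #|[set: gT]%SET| ->
    coset 'O_p^'([set: gT]%SET) x = coset 'O_p^'([set: gT]%SET) y) ->
  x = y.
Proof.
move=> xy; apply/eqP; rewrite eq_mulVg1 -order_eq1; apply: contraT => z1.
have dvd_z : #[x^-1 * y] %| #|[set: gT]%SET|.
  by rewrite order_dvdG ?finset.in_setT.
have p_pr : prime (pdiv #[x^-1 * y]).
  by apply: pdiv_prime; have := order_gt0 (x^-1 * y); case: #[_] z1 => [|[]].
set p := pdiv _ in p_pr.
have nO := @mem_norm_pcoreT gT (p^')%N.
have zO : x^-1 * y \in 'O_p^'([set: gT]%SET).
  rewrite coset_idr ?nO// morphM ?groupV ?nO// morphV ?nO//= xy ?mulVg//.
  exact: dvdn_trans (pdiv_dvd _) dvd_z.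
have pi_z : p \in \pi(#[x^-1 * y]).
  by rewrite pi_pdiv ltn_neqAle eq_sym z1 order_gt0.
by have := pnatPpi (mem_p_elt (pcore_pgroup _ _) zO) pi_z; rewrite !inE eqxx.
Qed.

Definition part_exponent (n p : nat) : nat := chinese (n`_p)%N (n`_p^')%N 1 0.

(** Since the n_q-th power of [x] is 1, only the exponent modulo n_q counts. For p different from q
    it is a multiple of n_{p'}, hence of n_q. *)
Lemma expg_part_exponent (gT : finGroupType) (x : gT) (n p q : nat) :
  #|[set: gT]%SET| = (n`_q)%N ->
  x ^+ part_exponent n p = if p == q then x else 1.
Proof.
move=> cardT; have co := coprime_partC p n n.
have xq : x ^+ (n`_q)%N = 1 by rewrite -cardT expg_cardG ?finset.in_setT.
case: eqVneq => [pq|neq].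
  rewrite -pq in xq; rewrite -(expg_mod _ xq) chinese_modl//.
  by rewrite (expg_mod _ xq) expg1.
apply/eqP; rewrite -order_dvdn; apply: (@dvdn_trans (n`_q)%N).
  by rewrite order_dvdn xq.
apply: (@dvdn_trans (n`_p^')%N).
  by apply: sub_in_partn => r _; rewrite !inE => /eqP->; rewrite eq_sym.
by rewrite /dvdn chinese_modr// mod0n.
Qed.

Theorem proposition2p2 (F : groupType) (n : nat) (H : 'I_n -> set F)
    (hH : forall i : 'I_n, is_subgroup (H i)) :
  Cl_nil (product_set H) =
  \bigcap_(p in [set p : nat | prime p]) Cl_p p (product_set H).
Proof.
apply/seteqP; split=> [x clx p _|x clx].
  by apply: Cl_sub clx => Q; exact: pgroup_nil.
apply/ClP => Q nilQ f.
pose O p := 'O_p^'([set: Q]%SET)%G.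
have cosetM p : {morph coset (O p) \o f : a b / a * b}.
  by move=> a b; rewrite /= gmulfM morphM// mem_norm_pcoreT.
pose fO p : {multiplicative F -> coset_of (O p)} :=
  HB.pack (coset (O p) \o f) (isMultiplicative.Build _ _ _ (cosetM p)).
have /choice[h hP] (p : nat) : exists h : 'I_n -> F, prime p ->
    (forall i, H i (h i)) /\ fO p (\prod_(i < n) h i) = fO p x.
  (* At non-primes the constant 1 is a filler: [k] below multiplies over primes only. *)
  case p_pr: (prime p); last by exists (fun=> 1).
  have pO : Gp p (coset_of (O p)).
    by rewrite /= /pgroup card_quotient_pcore// part_pnat.
  have [_ [h Hh ->] fh] := (ClP _ _ _ _).1 (clx p p_pr) _ pO (fO p).
  by exists h.
pose m := #|[set: Q]%SET|.
(* The bound [m.+1] lets the range contain every prime divisor of |Q|. *)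
pose k i := \prod_(0 <= p < m.+1 | prime p) h p i ^+ part_exponent m p.
exists (\prod_(i < n) k i).
  exists k => // i; apply: subgroup_prod => // p /hP[Hh _].
  exact: subgroupX.
apply: pcore_separates => q q_pr q_m.
rewrite -![coset _ (f _)]/(fO q _) -(hP q q_pr).2 !multiplicative_prod.
apply: eq_bigr => i _; rewrite multiplicative_prod.
(* The quotient of Q by O_{q'}(Q) has order m_q, so the factor at p becomes the image of [h q i] if
   p = q, and 1 otherwise. *)
under eq_bigr => p _ do rewrite multiplicativeX
  (@expg_part_exponent _ _ _ _ q (card_quotient_pcore _ _ nilQ)).
rewrite -big_mkcondr /=.
rewrite (eq_bigl (pred1 q)) => [|p]; last first.
  by rewrite /=; case: eqVneq => [->|]; rewrite ?q_pr ?andbF.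
(* The single remaining index q lies in the range because q divides m > 0. *)
by rewrite big_nat1_eq /= ltnS dvdn_leq ?cardG_gt0.
Qed.
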